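(* Consider the following dispersion process on the two-way infinite path $L$ with vertex set $\mathbb{Z}$ and edges $\{i,i+1\}$, $i\in\mathbb{Z}$. Initially $n$ particles are placed at the vertex $0$ and all other vertices are empty. Time is discrete; at each time step, every particle located at a vertex currently holding at least $2$ particles moves to one of the two neighbours of that vertex ($i-1$ or $i+1$), each with probability $1/2$, independently of all other choices, while every particle that is alone at its vertex stays put. The process stops at the first time $T$ at which every vertex holds at most one particle. Then there is an absolute constant $K>0$ such that, with probability tending to $1$ as $n\to\infty$, the process stops (i.e. $T<\infty$) and at time $T$ every particle is at distance at most $Kn$ from the origin.
   Context: ''With high probability'' (w.h.p.) means with probability tending to $1$ as $n\to\infty$. The statement that the furthest particle from the origin is at distance $O(n)$ when the process stops w.h.p. is expressed by the existence of the constant $K$ above. *)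

(* Defs.v *)
From HB Require Import structures.
From mathcomp Require Import all_boot all_order all_algebra finmap.
From mathcomp Require Import all_classical all_reals all_analysis.

Set Implicit Arguments.
Unset Strict Implicit.
Unset Printing Implicit Defensive.

Import Order.TTheory GRing.Theory Num.Theory.
Import numFieldNormedType.Exports.

Local Open Scope classical_set_scope.
Local Open Scope ring_scope.

Section Dispersion.
Variable n : nat.

Implicit Types x : 'I_n -> int.

Definition occupancy x (v : int) : nat := #|[pred i | x i == v]|.

Definition dispersed x : Prop := forall v : int, (occupancy x v <= 1)%N.

(* [c i] is the direction chosen for particle [i]; it is ignored when the
   particle is alone. *)
Definition step (c : 'I_n -> bool) x (i : 'I_n) : int :=
  if (2 <= occupancy x (x i))%N then x i + (if c i then 1 else -1) else x i.

Fixpoint position (c : nat -> 'I_n -> bool) (t : nat) : 'I_n -> int :=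
  if t is s.+1 then step (c s) (position c s) else fun=> 0.

Definition stops_at (c : nat -> 'I_n -> bool) (t : nat) : Prop :=
  dispersed (position c t) /\
  forall s : nat, (s < t)%N -> ~ dispersed (position c s).

Definition stops_within (R : realType) (r : R) (c : nat -> 'I_n -> bool) : Prop :=
  exists2 t : nat, stops_at c t &
    forall i : 'I_n, `|position c t i|%:~R <= r.

End Dispersion.

Section Probability.
Context (d d' : measure_display) (T : measurableType d) (U : measurableType d')
        (R : realType) (P : probability T R).

Definition mutually_independent (I : choiceType) (X : I -> {RV P >-> U}) : Prop :=
  forall (J : {fset I}) (A : I -> set U), (forall i, measurable (A i)) ->
    P (\bigcap_(i in [set` J]) (X i @^-1` A i)) =
    (\prod_(i <- J) P (X i @^-1` A i))%E.

End Probability.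

Definition iid_fair_coins (d : measure_display) (T : measurableType d)
    (R : realType) (P : probability T R) (I : choiceType)
    (X : I -> {RV P >-> bool}) : Prop :=
  mutually_independent X /\
  forall (i : I) (b : bool), P (X i @^-1` [set b]) = (2^-1)%:E.

(* Main.v *)
(** Give an occupied site [v] the weight [2^(-v) * 24^(-N)], where [N] is the
    number of particles strictly to the right of [v], and let the potential be
    the sum of these weights.  In one step every occupied site [v] of the new
    configuration can be charged to an occupied site of the old one among [v - 1],
    [v] and [v + 1], in such a way that a site holding a single particle receives
    at most its own weight, while a site holding [k >= 2] particles receives at
    most twice its weight if all its particles go left (probability
    [2^(-k) <= 1/4]) and at most [5/8] of it otherwise.  So the mean charge of such
    a site is at most [31/32] of its weight, and the potential is a
    supermartingale starting at [1].  Adding the mirror image of the potential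
    gives an energy which

    - is at least [2^(5n) / 24^n = (4/3)^n] if some particle is further than [5n]
      from the origin, and
    - decreases in mean by at least [24^(-n) / 32] as long as the process has not
      stopped,

    so that at a large time [t] the process has stopped within distance [5n]
    except with probability [O((3/4)^n)]. *)

Require Import Defs.
From HB Require Import structures.
From mathcomp Require Import all_boot all_order all_algebra finmap.
From mathcomp Require Import all_classical all_reals all_analysis.
From mathcomp Require Import zify lra.

Set Implicit Arguments.
Unset Strict Implicit.
Unset Printing Implicit Defensive.

Import Order.TTheory GRing.Theory Num.Theory.
Import numFieldNormedType.Exports.

Local Open Scope classical_set_scope.
Local Open Scope ring_scope.

(** Only indices in both lists contribute on the left, and each occurs once. This re-indexes charges
    by the site that receives them. *)
Lemma ler_sum_uniq_supp (R : numDomainType) (I : eqType) (s t : seq I)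
    (G : I -> R) : uniq s -> uniq t -> (forall u, 0 <= G u) ->
  (forall u, u \notin t -> G u = 0) ->
  \sum_(u <- s) G u <= \sum_(u <- t) G u.
Proof.
move=> us ut G0 Gt.
rewrite (bigID (mem t)) /= [X in _ + X]big1 => [|u ut']; last exact: Gt.
rewrite addr0 [leRHS](bigID (mem s)) /=.
rewrite -[X in X <= _]big_filter -[X in _ <= X + _]big_filter.
rewrite (perm_big [seq u <- t | u \in s]) /=; last first.
  by apply: uniq_perm; rewrite ?filter_uniq// => u; rewrite !mem_filter andbC.
by rewrite lerDl; apply: sumr_ge0.
Qed.

(** * Sites, weights and the potential *)

Section Potential.
Context (R : realType) (n : nat).
Implicit Types (x : 'I_n -> int) (v p : int).

Definition active x v : bool := (2 <= occupancy x v)%N.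

Definition right_of x v : nat := (\sum_(i < n) (v < x i)%R)%N.

(** The activity test discards the coin of a lone particle, so only actual moves are counted. *)
Definition right_movers (c : 'I_n -> bool) x v : nat :=
  (\sum_(i < n) [&& active x v, x i == v & c i])%N.

Definition sites x : seq int := undup (codom x).

Definition weight x v : R := 2 ^ (- v) * 24^-1 ^+ right_of x v.

Definition potential x : R := \sum_(v <- sites x) weight x v.

Lemma mem_sites x v : v \in sites x = [exists i, x i == v].
Proof.
rewrite mem_undup; apply/codomP/existsP => -[i].
  by move=> ->; exists i.
by move=> /eqP <-; exists i.
Qed.

Lemma active_sites x v : active x v -> v \in sites x.
Proof.
rewrite /active mem_sites => h; have : (0 < occupancy x v)%N by lia.
by move=> /card_gt0P[i]; rewrite inE => xi; apply/existsP; exists i.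
Qed.

Lemma stepE c x i : step c x i =
  x i + (if active x (x i) then if c i then 1 else -1 else 0).
Proof. by rewrite /step /active; case: ifP => // _; rewrite addr0. Qed.

Lemma right_movers_gt0 (c : 'I_n -> bool) x v i :
  active x v -> x i = v -> c i -> (0 < right_movers c x v)%N.
Proof.
by move=> av xi ci; rewrite /right_movers (bigD1 i) //= av xi eqxx ci.
Qed.

Lemma weight_ge0 x v : 0 <= weight x v.
Proof. by rewrite mulr_ge0// ?exprz_ge0// exprn_ge0// invr_ge0. Qed.

Lemma weight_le x y u v m : (right_of x u + m <= right_of y v)%N ->
  weight y v <= 2 ^ (u - v) * (weight x u * 24^-1 ^+ m).
Proof.
move=> h; rewrite /weight !mulrA -expfzDr// addrAC subrr add0r -mulrA -exprD.
apply: ler_wpM2l; first exact: exprz_ge0.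
by apply: ler_wiXn2l => //; lra.
Qed.

(** * Deterministic charging of new sites to old ones *)

(** Particles from [v + 2] on move back by at most one and remain beyond [v]; the right movers of
    [v + 1] and [v] also end beyond [v] and were not yet counted. *)
Lemma right_of_active c x v : active x (v + 1) ->
  (right_of x (v + 1) + (right_movers c x (v + 1) + right_movers c x v)
   <= right_of (step c x) v)%N.
Proof.
move=> av; rewrite -!big_split /=; apply: leq_sum => i _; rewrite stepE.
have [->|n1] := eqVneq (x i) v.
  case: (active x v) (c i) => -[] /=; rewrite ?av; lia.
have [->|n2] := eqVneq (x i) (v + 1); first by rewrite av; case: (c i); lia.
rewrite !andbF; case: (active _ _) (c i) => -[]; lia.
Qed.

(** Nothing leaves [v + 1], so no particle beyond [v] can fall back to [v], while the right movers
    of [v] are gained. *)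
Lemma right_of_inactive c x v : ~~ active x (v + 1) ->
  (right_of x v + right_movers c x v <= right_of (step c x) v)%N.
Proof.
move=> av; rewrite -!big_split /=; apply: leq_sum => i _; rewrite stepE.
have [->|n1] := eqVneq (x i) v.
  by case: (active x v) (c i) => -[] /=; lia.
have [->|n2] := eqVneq (x i) (v + 1); first by rewrite (negbTE av); lia.
rewrite !andbF; case: (active _ _) (c i) => -[]; lia.
Qed.

(* The charges put on [p] by the new sites [p - 1], [p] and [p + 1].  A new site
   [v] charges [v + 1] if [v + 1] is active, else [v] if [v] was occupied, else
   [v - 1], from which its particles must have come. *)
Definition left_share (c : 'I_n -> bool) x p : R :=
  if active x p then
    2 * (weight x p * 24^-1 ^+ (right_movers c x p + right_movers c x (p - 1)))
  else 0.

Definition own_share (c : 'I_n -> bool) x p : R :=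
  if active x p then
    if (0 < right_movers c x (p - 1))%N
    then weight x p * 24^-1 ^+ right_movers c x p else 0
  else if p \in sites x then weight x p else 0.

Definition right_share (c : 'I_n -> bool) x p : R :=
  if (0 < right_movers c x p)%N then 2^-1 * weight x p else 0.

Lemma left_share_ge0 c x p : 0 <= left_share c x p.
Proof.
rewrite /left_share; case: ifP => // _; apply: mulr_ge0 => //.
by apply: mulr_ge0; [exact: weight_ge0|rewrite exprn_ge0// invr_ge0].
Qed.

Lemma own_share_ge0 c x p : 0 <= own_share c x p.
Proof.
rewrite /own_share; case: ifP => _; case: ifP => // _; last exact: weight_ge0.
by rewrite mulr_ge0 ?weight_ge0// exprn_ge0// invr_ge0.
Qed.

Lemma right_share_ge0 c x p : 0 <= right_share c x p.
Proof.
by rewrite /right_share; case: ifP => // _; rewrite mulr_ge0 ?weight_ge0.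
Qed.

Lemma right_movers_active c x p : (0 < right_movers c x p)%N -> active x p.
Proof.
apply: contraTT => /negbTE ap; rewrite /right_movers big1// => i _.
by rewrite ap.
Qed.

(** An inactive [v + 1] sends nothing, and [v] keeps no particle since it was empty or all its
    particles left; [v - 1] is the only remaining source. *)
Lemma arrival c x v : v \in sites (step c x) -> ~~ active x (v + 1) ->
  (v \notin sites x) || active x v -> (0 < right_movers c x (v - 1))%N.
Proof.
rewrite mem_sites => /existsP[i]; rewrite stepE => /eqP yi av1 h.
have [xi|xi] := eqVneq (x i) v.
  move: h yi; rewrite mem_sites -{1 2 3}xi; case/orP => [/existsP|->].
    by case; exists i.
  by rewrite xi; case: (c i); lia.
have [xi1|xi1] := eqVneq (x i) (v + 1).
  by move: yi; rewrite xi1 (negbTE av1); lia.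
case ai: (active x (x i)) yi => yi; last lia.
case ci: (c i) yi => yi; last lia.
have xiv : x i = v - 1 by lia.
by apply: (@right_movers_gt0 _ _ _ i) => //; rewrite -xiv.
Qed.

Lemma weight_step_le c x v : v \in sites (step c x) ->
  weight (step c x) v <=
    left_share c x (v + 1) + own_share c x v + right_share c x (v - 1).
Proof.
move=> vy; case: (boolP (active x (v + 1))) => av1.
  rewrite (le_trans (weight_le (right_of_active c av1)))//.
  rewrite (_ : v + 1 - v = 1) ?expr1z; last by lia.
  rewrite -addrA /left_share av1 addrK lerDl addr_ge0//.
    exact: own_share_ge0.
  exact: right_share_ge0.
have arr := arrival vy av1.
have le_own : weight (step c x) v <= own_share c x v ->
    weight (step c x) v <=
    left_share c x (v + 1) + own_share c x v + right_share c x (v - 1).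
  move=> /le_trans; apply; rewrite addrAC lerDr addr_ge0//.
    exact: left_share_ge0.
  exact: right_share_ge0.
have w := weight_le (right_of_inactive c av1).
rewrite subrr expr0z mul1r in w.
case: (boolP (active x v)) => av.
  apply: le_own; rewrite /own_share av arr ?av ?orbT//.
have w0 : weight (step c x) v <= weight x v.
  apply: (le_trans w); rewrite ler_piMr ?weight_ge0// exprn_ile1//; lra.
case: (boolP (v \in sites x)) => vx.
  by apply: le_own; rewrite /own_share (negbTE av) vx.
rewrite vx in arr.
(* As [v] was empty, both sites see the same particles to their right, and the weights differ only
   by the factor 1/2. *)
have rv : right_of x v = right_of x (v - 1).
  apply: eq_bigr => i _; have : x i != v.
    by apply: contra vx => xi; rewrite mem_sites; apply/existsP; exists i.
  by move=> ?; congr nat_of_bool; apply/idP/idP; lia.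
rewrite (le_trans w0)// {1}/weight rv.
rewrite (_ : - v = - 1 - (v - 1)); last by lia.
rewrite expfzDr// -mulrA -/(weight x (v - 1)) /right_share arr//.
rewrite exprN1 lerDr addr_ge0//.
  exact: left_share_ge0.
exact: own_share_ge0.
Qed.

(** With a right mover at [p] the shares are at most 2/24 + 1/24 + 1/2 = 5/8. Without one there is
    no right share: an arrival from [p - 1] gives at most 2/24 + 1, and no arrival makes the own
    share vanish and leaves 2. *)
Definition share_bound (c : 'I_n -> bool) x p : R :=
  if active x p then if right_movers c x p == 0%N then 2 else 5 / 8 else 1.

Lemma shares_le c x p : p \in sites x ->
  left_share c x p + own_share c x p + right_share c x p <=
  weight x p * share_bound c x p.
Proof.
move=> px; rewrite /left_share /own_share /right_share /share_bound px.
case: ifP => ap; last first.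
  have -> : (0 < right_movers c x p)%N = false.
    by apply/negbTE; apply: contraFN ap; exact: right_movers_active.
  by rewrite addr0 add0r mulr1.
have w0 := weight_ge0 x p.
have q0 m : 0 <= (24^-1 : R) ^+ m by rewrite exprn_ge0.
have q1 m : (0 < m)%N -> (24^-1 : R) ^+ m <= 24^-1.
  by case: m => // m _; rewrite exprS ler_piMr// exprn_ile1//; lra.
have ql m : (24^-1 : R) ^+ m <= 1 by rewrite exprn_ile1//; lra.
case: (right_movers c x p) => [|r] /=; rewrite ?add0n ?expr0 ?addr0.
  case: ifP => [/q1|_]; last by have := ql (right_movers c x (p - 1)); nra.
  by nra.
have a := q1 r.+1 isT.
have b : (24^-1 : R) ^+ (r.+1 + right_movers c x (p - 1)) <= 24^-1 by exact: q1.
by case: ifP => _; nra.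
Qed.

Lemma potential_step_le c x :
  potential (step c x) <= \sum_(p <- sites x) weight x p * share_bound c x p.
Proof.
have us y : uniq (sites y) by exact: undup_uniq.
have shift (G : int -> R) k : (forall u, 0 <= G u) ->
    (forall u, u \notin sites x -> G u = 0) ->
    \sum_(v <- sites (step c x)) G (v + k) <= \sum_(p <- sites x) G p.
  move=> G0 Gx; rewrite -(big_map (fun v => v + k) xpredT G).
  by apply: ler_sum_uniq_supp => //; rewrite map_inj_uniq//; exact: addIr.
have Nact p : p \notin sites x -> active x p = false.
  by move=> px; apply/negbTE; apply: contra px; exact: active_sites.
apply: (@le_trans _ _ (\sum_(v <- sites (step c x))
    (left_share c x (v + 1) + own_share c x (v + 0) + right_share c x (v - 1)))).
  rewrite /potential big_seq [leRHS]big_seq; apply: ler_sum => v vy.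
  by rewrite addr0; exact: weight_step_le.
apply: (@le_trans _ _ (\sum_(p <- sites x)
    (left_share c x p + own_share c x p + right_share c x p))).
  rewrite !big_split /=; apply: lerD; first apply: lerD; apply: shift => p.
  - exact: left_share_ge0.
  - by move=> /Nact ap; rewrite /left_share ap.
  - exact: own_share_ge0.
  - by move=> px; rewrite /own_share Nact// (negbTE px).
  - exact: right_share_ge0.
  - move=> /Nact ap; rewrite /right_share; case: ifP => //.
    by move=> /right_movers_active; rewrite ap.
by rewrite big_seq [leRHS]big_seq; apply: ler_sum => p; exact: shares_le.
Qed.

(** * Averaging over one round of coins *)

Definition coin_mean (f : {ffun 'I_n -> bool} -> R) : R :=
  2^-1 ^+ n * \sum_c f c.

Lemma coin_mean_le f g : (forall c, f c <= g c) -> coin_mean f <= coin_mean g.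
Proof.
by move=> fg; rewrite /coin_mean ler_wpM2l//; apply: ler_sum => c _.
Qed.

Lemma coin_meanD f g :
  coin_mean (fun c => f c + g c) = coin_mean f + coin_mean g.
Proof. by rewrite /coin_mean big_split mulrDr. Qed.

Lemma coin_meanZ k f : coin_mean (fun c => k * f c) = k * coin_mean f.
Proof. by rewrite /coin_mean -mulr_sumr mulrCA. Qed.

Lemma coin_mean_cst k : coin_mean (fun=> k) = k.
Proof.
rewrite /coin_mean sumr_const card_ffun card_bool card_ord.
rewrite -[k *+ _]mulr_natl mulrA natrX -exprMn mulVf// expr1n mul1r//.
Qed.

Lemma coin_mean_sum (I : Type) (s : seq I) (F : I -> {ffun 'I_n -> bool} -> R) :
  coin_mean (fun c => \sum_(j <- s) F j c) = \sum_(j <- s) coin_mean (F j).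
Proof. by rewrite /coin_mean exchange_big mulr_sumr. Qed.

Lemma coin_mean_no_right_movers x p : active x p ->
  coin_mean (fun c => (right_movers c x p == 0%N)%:R) <= 4^-1.
Proof.
move=> ap; pose h i (b : bool) : R := 2^-1 * (~~ ((x i == p) && b))%:R.
(* The indicator is bounded by a product over particles so that the sum over coins factors: each
   particle at [p] contributes 1/2, every other one 1, and at least two are at [p]. *)
apply: (@le_trans _ _ (\sum_(c : {ffun 'I_n -> bool}) \prod_i h i (c i))).
  rewrite /coin_mean mulr_sumr; apply: ler_sum => c _.
  have h0 : 0 <= \prod_i h i (c i).
    by apply: prodr_ge0 => i _; rewrite /h mulr_ge0// invr_ge0.
  case: eqP => [/eqP r0|_]; last by rewrite mulr0.
  rewrite mulr1 -[X in _ ^+ X](card_ord n) -prodr_const ler_prod// => i _.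
  rewrite invr_ge0 ler0n/= /h; case: (boolP (_ && _)) => [/andP[/eqP xi ci]|].
    by have := right_movers_gt0 ap xi ci; rewrite (eqP r0).
  by rewrite mulr1.
rewrite -(bigA_distr_bigA h) (eq_bigr (fun i => if x i == p then 2^-1 else 1)).
  rewrite -big_mkcond /= prodr_const.
  rewrite (@le_trans _ _ (2^-1 ^+ 2))//; last by lra.
  by apply: ler_wiXn2l => //; lra.
move=> i _; rewrite big_bool /h; case: eqP => _ /=; lra.
Qed.

(** The value 2 has probability at most 1/4, and 5/8 + (11/8)(1/4) = 31/32. *)
Lemma coin_mean_share_bound x p :
  coin_mean (fun c => share_bound c x p) <= if active x p then 31 / 32 else 1.
Proof.
case: ifP => ap; rewrite /share_bound ap; last by rewrite coin_mean_cst.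
have -> : (fun c : {ffun 'I_n -> bool} => if right_movers c x p == 0%N
    then 2 else 5 / 8 : R) =
    (fun c : {ffun 'I_n -> bool} =>
       5 / 8 + 11 / 8 * (right_movers c x p == 0%N)%:R).
  by apply/funext => c; case: (_ == _); rewrite ?mulr1 ?mulr0 /=; lra.
rewrite coin_meanD coin_mean_cst coin_meanZ.
by have := coin_mean_no_right_movers ap; lra.
Qed.

Lemma coin_mean_potential x : coin_mean (fun c => potential (step c x)) <=
  potential x - 32^-1 * \sum_(p <- sites x | active x p) weight x p.
Proof.
apply: (le_trans (coin_mean_le (fun c => potential_step_le c x))).
rewrite coin_mean_sum /potential mulr_sumr [X in _ - X]big_mkcond -sumrB.
apply: ler_sum => p _; rewrite coin_meanZ.
have := coin_mean_share_bound x p; have := weight_ge0 x p.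
by case: (active x p); nra.
Qed.

(** * Reflection and the energy *)

Definition reflection x i : int := - x i.

Lemma active_reflection x v : active (reflection x) (- v) = active x v.
Proof.
rewrite /active /occupancy; congr (_ <= _)%N; apply: eq_card => i.
by rewrite !inE /reflection eqr_opp.
Qed.

Lemma reflection_step c x :
  reflection (step c x) = step [ffun i => ~~ c i] (reflection x).
Proof.
apply/funext => i; rewrite /reflection !stepE active_reflection ffunE.
by rewrite opprD; case: (active _ _) (c i) => -[].
Qed.

Definition energy x : R := potential x + potential (reflection x).

Definition unsettled x : bool := [exists i, active x (x i)].

Lemma dispersedP x : dispersed x <-> ~~ unsettled x.
Proof.
rewrite /unsettled negb_exists; split=> [dx|/forallP dx v].
  by apply/forallP => i; rewrite /active -ltnNge ltnS dx.
rewrite leqNgt; apply/negP => av.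
have := active_sites av; rewrite mem_sites => /existsP[i /eqP xi].
by have := dx i; rewrite xi /active av.
Qed.

Lemma step_dispersed c x : dispersed x -> step c x = x.
Proof.
move=> /dispersedP; rewrite negb_exists => /forallP dx.
by apply/funext => i; rewrite stepE (negbTE (dx i)) addr0.
Qed.

Lemma weight_ge x v : 2 ^ (- v) * 24^-1 ^+ n <= weight x v.
Proof.
rewrite ler_wpM2l ?exprz_ge0//; apply: ler_wiXn2l => //; first lra.
rewrite /right_of (leq_trans (n := \sum_(i < n) 1))//.
  by apply: leq_sum => i _; case: (_ < _).
by rewrite sum1_card card_ord.
Qed.

Lemma potential_ge0 x : 0 <= potential x.
Proof. by apply: sumr_ge0 => v _; exact: weight_ge0. Qed.

Lemma weight_le_potential x i : weight x (x i) <= potential x.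
Proof.
have xs : x i \in sites x by rewrite mem_sites; apply/existsP; exists i.
rewrite /potential (big_rem _ xs) /= lerDl.
by apply: sumr_ge0 => v _; exact: weight_ge0.
Qed.

Lemma coin_mean_energy x : coin_mean (fun c => energy (step c x)) <=
  energy x - 32^-1 * 24^-1 ^+ n * (unsettled x)%:R.
Proof.
have refl : coin_mean (fun c => potential (reflection (step c x))) =
    coin_mean (fun c => potential (step c (reflection x))).
  rewrite /coin_mean; congr (_ * _).
  pose neg (c : {ffun 'I_n -> bool}) := [ffun i => ~~ c i].
  (* Mirroring exchanges left and right; flipping every coin is an involution, so the uniform mean
     is unchanged. *)
  rewrite [RHS](reindex neg); last first.
    by exists neg => c _; apply/ffunP => i; rewrite !ffunE negbK.
  by apply: eq_bigr => c _; rewrite reflection_step.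
rewrite coin_meanD refl /energy.
have le1 := coin_mean_potential x.
have le2 := coin_mean_potential (reflection x).
set S1 := \sum_(_ <- _ | _) _ in le1; set S2 := \sum_(_ <- _ | _) _ in le2.
have w0 : forall y, 0 <= \sum_(p <- sites y | active y p) weight y p.
  by move=> y; apply: sumr_ge0 => p _; exact: weight_ge0.
suff : 24^-1 ^+ n * (unsettled x)%:R <= S1 + S2 by lra.
case: (boolP (unsettled x)) => [/existsP[i ai]|_]; last first.
  by rewrite mulr0 addr_ge0 ?w0.
rewrite mulr1.
(* At a site [v <= 0] the factor [2 ^ (- v)] is at least 1. An active site on the positive side is
   handled in the mirror image. *)
have large y : active y (y i) -> y i <= 0 ->
    24^-1 ^+ n <= \sum_(p <- sites y | active y p) weight y p.
  move=> ay y0; rewrite (big_rem (y i)) /=; last exact: active_sites.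
  rewrite ay (@le_trans _ _ (weight y (y i)))//.
    rewrite (le_trans _ (weight_ge _ _))// ler_peMl//.
    have : 0 <= - y i by lia.
    by case: (- y i) => // m _; rewrite -exprnP exprn_ege1// ler1n.
  by rewrite lerDl; apply: sumr_ge0 => p _; exact: weight_ge0.
have [xi|xi] := leP (x i) 0.
  by rewrite (le_trans (large _ ai xi))// lerDl w0.
rewrite (le_trans (large (reflection x) _ _)) ?lerDr ?w0//.
  by rewrite active_reflection.
by rewrite /reflection; lia.
Qed.

(** * Means after several steps *)

Fixpoint mean_after t (f : ('I_n -> int) -> R) x : R :=
  if t is s.+1 then coin_mean (fun c => mean_after s f (step c x)) else f x.

(** The definition peels off the first step; the supermartingale argument needs the last one. *)
Lemma mean_afterSr t f x : mean_after t.+1 f x =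
  mean_after t (fun y => coin_mean (fun c => f (step c y))) x.
Proof.
elim: t x => // t IH x; rewrite [RHS]/= -[LHS]/(coin_mean _).
by congr coin_mean; apply/funext => c; rewrite -IH.
Qed.

Lemma mean_after_le t f g x :
  (forall y, f y <= g y) -> mean_after t f x <= mean_after t g x.
Proof.
move=> fg; elim: t x => [|t IH] x; first exact: fg.
exact: coin_mean_le.
Qed.

Lemma mean_afterZ t k f x :
  mean_after t (fun y => k * f y) x = k * mean_after t f x.
Proof.
elim: t x => //= t IH x; rewrite -coin_meanZ.
by congr coin_mean; apply/funext => c; rewrite IH.
Qed.

Definition rate : R := 32^-1 * 24^-1 ^+ n.

(* The second term telescopes the decrease of the energy at the times up to [t]
   at which the process has not stopped, since being unsettled is decreasing. *)
Lemma mean_after_energy t x : mean_after t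
  (fun y => energy y + t%:R * rate * (unsettled y)%:R) x <= energy x.
Proof.
elim: t => [|t IH]; first by rewrite /= !mul0r addr0.
rewrite mean_afterSr (le_trans _ IH)// mean_after_le// => y.
rewrite coin_meanD coin_meanZ.
have settled : coin_mean (fun c => (unsettled (step c y))%:R) <=
    (unsettled y)%:R.
  rewrite -[leRHS]coin_mean_cst; apply: coin_mean_le => c.
  case: (boolP (unsettled y)) => [_|uy]; first by rewrite ler_nat leq_b1.
  by rewrite step_dispersed ?(negbTE uy)//; apply/dispersedP.
have r0 : 0 <= rate by rewrite mulr_ge0 ?exprn_ge0 ?invr_ge0.
have tr0 : 0 <= t.+1%:R * rate by rewrite mulr_ge0.
have := coin_mean_energy y; rewrite -/rate.
have := ler_wpM2l tr0 settled; rewrite -natr1.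
by case: (unsettled y); nra.
Qed.

Definition far x : bool := [exists i, (5 * n)%N%:Z < `|x i|].

Lemma far_energy x : far x -> (4 / 3) ^+ n <= energy x.
Proof.
move=> /existsP[i xi].
have large y : (5 * n)%N%:Z < - y i -> (4 / 3) ^+ n <= potential y.
  move=> yi; rewrite (le_trans _ (weight_le_potential y i))//.
  rewrite (le_trans _ (weight_ge _ _))//.
  (* The 5 in [far] is the least exponent for which the power of 2 exceeds 24. *)
  rewrite (_ : 4 / 3 = 2 ^+ 5 * 24^-1); last by lra.
  rewrite exprMn ler_wpM2r// -exprM.
  case: (- y i) yi => // m; rewrite -exprnP ltz_nat => /ltnW.
  by apply: ler_weXn2l; rewrite ler1n.
rewrite /energy; have [x0|x0] := leP 0 (x i).
  rewrite (le_trans (large (reflection x) _)) ?lerDr ?potential_ge0//.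
  by rewrite /reflection; lia.
by rewrite (le_trans (large x _)) ?lerDl ?potential_ge0//; lia.
Qed.

(** Each potential is 1 when the origin is occupied, and 0 when [n] is 0, hence an inequality. *)
Lemma energy0 : energy (fun=> 0) <= 2.
Proof.
have p0 : potential (fun=> 0) <= 1.
  rewrite (@le_trans _ _ (\sum_(v <- sites (fun=> 0)) (v == 0)%:R))//.
    rewrite /potential big_seq [leRHS]big_seq; apply: ler_sum => v.
    rewrite mem_sites => /existsP[i /eqP <-].
    by rewrite /weight eqxx oppr0 expr0z mul1r exprn_ile1//; lra.
  rewrite (@le_trans _ _ (\sum_(v <- [:: 0%:Z]) (v == 0)%:R))//; last first.
    by rewrite big_seq1.
  apply: ler_sum_uniq_supp => //; first exact: undup_uniq.
  by move=> u; rewrite inE => /negbTE ->.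
rewrite /energy (_ : reflection (fun=> 0) = fun=> 0); first lra.
by apply/funext => i; rewrite /reflection oppr0.
Qed.

(** Markov's inequality: the second summand of the factor makes the unsettled term reach 1, the
    first does so for the energy of a far configuration, and the initial energy is at most 2. *)
Lemma mean_after_bad t : (0 < t)%N ->
  mean_after t (fun x => (unsettled x || far x)%:R) (fun=> 0) <=
  ((3 / 4) ^+ n + (t%:R * rate)^-1) * 2.
Proof.
move=> t0; have r0 : 0 < rate by rewrite mulr_gt0 ?exprn_gt0 ?invr_gt0.
have tr0 : 0 < t%:R * rate by rewrite mulr_gt0// ltr0n.
have q0 : 0 < (3 / 4 : R) ^+ n by rewrite exprn_gt0.
set k := _ + _^-1; have k0 : 0 <= k by rewrite ltW// addr_gt0// invr_gt0.
apply: (@le_trans _ _ (k * mean_after t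
    (fun y => energy y + t%:R * rate * (unsettled y)%:R) (fun=> 0))).
  rewrite -mean_afterZ; apply: mean_after_le => y.
  have e0 : 0 <= energy y by rewrite addr_ge0 ?potential_ge0.
  have u0 : 0 <= (unsettled y)%:R :> R by [].
  case: (boolP (unsettled y)) => uy /=.
    rewrite mulr1 mulrDr ler_wpDl ?mulr_ge0// /k mulrDl mulVf ?gt_eqF//.
    by rewrite lerDr mulr_ge0// ltW.
  rewrite mulr0 addr0; case: (boolP (far y)) => [/far_energy fy|_]; last first.
    by rewrite mulr_ge0.
  apply: (@le_trans _ _ ((3 / 4) ^+ n * (4 / 3) ^+ n)).
    by rewrite -exprMn (_ : 3 / 4 * (4 / 3) = 1) ?expr1n//; lra.
  by rewrite ler_pM// lerDl invr_ge0 ltW.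
by rewrite ler_wpM2l// (le_trans (mean_after_energy _ _))// energy0.
Qed.

End Potential.

(** * Transfer to the probability space *)

Lemma eq_position n (c c' : nat -> 'I_n -> bool) t :
  (forall s i, (s < t)%N -> c s i = c' s i) -> position c t = position c' t.
Proof.
elim: t => //= t IH h; rewrite IH => [|s i st]; last by apply: h; lia.
by congr step; apply/funext => i; exact: h.
Qed.

Lemma position_dispersed n (c : nat -> 'I_n -> bool) s t : (s <= t)%N ->
  dispersed (position c s) -> position c t = position c s.
Proof.
move=> + ds; elim: t => [|t IH]; first by rewrite leqn0 => /eqP ->.
rewrite leq_eqVlt => /predU1P[->//|]; rewrite ltnS => /IH /= ->.
exact: step_dispersed.
Qed.

Section Law.
Context (d : measure_display) (T : measurableType d) (R : realType).
Context (P : probability T R) (n : nat).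
Context (X : (nat * 'I_n)%type -> {RV P >-> bool}).
Context (coinsX : iid_fair_coins X).

Let coins w : nat -> 'I_n -> bool := fun t i => X (t, i) w.

Lemma measurable_coin j b : measurable (X j @^-1` [set b]).
Proof. exact: measurable_funPTI. Qed.

(** The last round of coins takes finitely many values; fixing it to [b] replaces [Q] by [Q] after
    [step b], which is why the induction runs over all [Q]. *)
Lemma measurable_position t (Q : pred ('I_n -> int)) :
  measurable [set w | Q (position (coins w) t)].
Proof.
elim: t Q => [|t IH] Q /=.
  by case: (Q _); [rewrite set_true|rewrite set_false].
have -> : [set w | Q (step (coins w t) (position (coins w) t))] =
    \bigcup_(b in [set: {ffun 'I_n -> bool}])
      ((\bigcap_(i in [set: 'I_n]) (X (t, i) @^-1` [set b i])) `&`
       [set w | Q (step b (position (coins w) t))]).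
  apply/seteqP; split => w /=.
    move=> Qw; exists [ffun i => X (t, i) w] => //; split.
      by move=> i _ /=; rewrite ffunE.
    by rewrite (_ : fun_of_fin _ = coins w t)//; apply/funext => i; rewrite ffunE.
  move=> [b _ [wb /= Qb]]; rewrite (_ : coins w t = b)//.
  by apply/funext => i; exact: wb.
apply: fin_bigcup_measurable => [|b _]; first exact: finite_finset.
apply: measurableI; last exact: (IH (fun x => Q (step b x))).
apply: fin_bigcap_measurable => [|i _]; first exact: finite_finset.
exact: measurable_coin.
Qed.

Let times t : {fset (nat * 'I_n)%type} :=
  seq_fset tt [seq (s, i) | s <- iota 0 t, i <- enum 'I_n].

Let mem_times t s i : ((s, i) \in times t) = (s < t)%N.
Proof.
rewrite seq_fsetE; apply/allpairsPdep/idP => [[s' [i' [+ _ [-> _]]]]|st].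
  by rewrite mem_iota.
by exists s, i; rewrite mem_iota mem_enum.
Qed.

Let size_times t : size (times t) = (t * n)%N.
Proof.
rewrite size_seq_fset undup_id ?size_allpairs ?size_iota ?size_enum_ord//.
apply: allpairs_uniq; rewrite ?iota_uniq ?enum_uniq//.
by move=> [? ?] [? ?].
Qed.

Let cylinder t (c : nat -> 'I_n -> bool) : set T :=
  \bigcap_(j in [set` times t]) (X j @^-1` [set c j.1 j.2]).

Let cylinderP t c w :
  cylinder t c w <-> forall s i, (s < t)%N -> X (s, i) w = c s i.
Proof.
split=> [cw s i st|cw [s i]]; first by apply: (cw (s, i)); rewrite /= mem_times.
by rewrite /= mem_times => /cw.
Qed.

Let measurable_cylinder t c : measurable (cylinder t c).
Proof.
apply: fin_bigcap_measurable => [|j _]; first exact: finite_fset.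
exact: measurable_coin.
Qed.

Let prob_cylinder t c : P (cylinder t c) = (2^-1 ^+ (t * n))%:E.
Proof.
have [indX fairX] := coinsX.
rewrite /cylinder (indX _ (fun j => [set c j.1 j.2]))//.
under eq_bigr do rewrite fairX.
by rewrite prodEFin big_const_seq count_predT size_times iter_mulr_1.
Qed.

(** Splitting by the coins of round [t] lengthens the cylinder by one round, and the extra factor
    [2^-1 ^+ n] turns the sum into [coin_mean]. Subadditivity is enough for an upper bound. *)
Lemma prob_cylinder_position m t c (Q : pred ('I_n -> int)) :
  (P (cylinder t c `&` [set w | Q (position (coins w) (t + m))]) <=
   (2^-1 ^+ (t * n) *
    mean_after m (fun x => (Q x)%:R) (position c t))%:E)%E.
Proof.
elim: m t c => [|m IH] t c.
  rewrite addn0 /=; case Qc: (Q (position c t)).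
    rewrite mulr1 -(prob_cylinder t c) le_measure ?inE//.
    by apply: measurableI => //; exact: measurable_position.
  rewrite (_ : _ `&` _ = set0) ?measure0 ?mulr0//.
  apply/seteqP; split => // w [/cylinderP cw /=].
  by rewrite (@eq_position _ _ c) ?Qc.
rewrite -addSnnS.
(* [c'] keeps the first [t] rounds of [c], hence the position at time [t], and prescribes [b] in
   round [t]. *)
pose c' (b : {ffun 'I_n -> bool}) s :=
  if s == t then b : 'I_n -> bool else c s.
have mB b : measurable (cylinder t.+1 (c' b) `&`
    [set w | Q (position (coins w) (t.+1 + m))]).
  by apply: measurableI => //; exact: measurable_position.
apply: (@le_trans _ _ (\sum_(b \in [set: {ffun 'I_n -> bool}])
    P (cylinder t.+1 (c' b) `&` [set w | Q (position (coins w) (t.+1 + m))]))%E).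
  apply: content_sub_fsum => //.
  - exact: finite_finset.
  - by apply: measurableI => //; exact: measurable_position.
  move=> w [/cylinderP cw Qw]; exists [ffun i => X (t, i) w] => //.
  split => //.
  apply/cylinderP => s i; rewrite ltnS leq_eqVlt /c'.
  by have [->|_ /= /cw] := eqVneq s t; rewrite ?ffunE.
rewrite fsbig_finite/=; last exact: finite_finset.
rewrite (perm_big (index_enum {ffun 'I_n -> bool})) /=; last first.
  apply: uniq_perm; rewrite ?fset_uniq ?index_enum_uniq// => b.
  by rewrite in_fset_set ?in_setT ?mem_index_enum//; exact: finite_finset.
apply: (@le_trans _ _ (\sum_(b : {ffun 'I_n -> bool}) (2^-1 ^+ (t.+1 * n) *
    mean_after m (fun x => (Q x)%:R) (step b (position c t)))%:E)%E).
  apply: lee_sum => b _; apply: le_trans (IH _ _) _; rewrite lee_fin /=.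
  rewrite (@eq_position _ (c' b) c) /c' ?eqxx// => s i st.
  by rewrite ltn_eqF.
rewrite sumEFin lee_fin -mulr_sumr /coin_mean mulrA -exprD.
by rewrite mulSn addnC.
Qed.

Lemma prob_position_le t (Q : pred ('I_n -> int)) :
  (P [set w | Q (position (coins w) t)] <=
   (mean_after t (fun x => (Q x)%:R) (fun=> 0))%:E)%E.
Proof.
have := prob_cylinder_position t 0 (fun _ _ => true) Q.
rewrite mul0n expr0 mul1r add0n setIidr//.
by move=> w _; apply/cylinderP.
Qed.

Let good : set T := [set w | stops_within (5 * n%:R : R) (coins w)].

(** * The stopping event and its limit probability *)

(** A dispersed configuration is frozen, so any dispersed time has the same positions as the first
    one. The event becomes a countable union of measurable ones. *)
Lemma stops_withinE : good =
  \bigcup_t [set w | ~~ (unsettled (position (coins w) t) ||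
                         far (position (coins w) t))].
Proof.
have nearE (x : 'I_n -> int) : ~~ far x <->
    forall i, `|x i|%:~R <= 5 * n%:R :> R.
  rewrite /far negb_exists -natrM; split=> [/forallP nx i|nx].
    by have := nx i; rewrite -leNgt -(ler_int R).
  by apply/forallP => i; rewrite -leNgt -(ler_int R); exact: nx.
apply/seteqP; split => w /=.
  move=> [t [dt _] nt]; exists t => //=; rewrite negb_or.
  by apply/andP; split; [apply/dispersedP|apply/nearE].
move=> [t _ /=]; rewrite negb_or => /andP[/dispersedP dt /nearE nt].
have ex : exists s, ~~ unsettled (position (coins w) s).
  by exists t; apply/dispersedP.
case: (ex_minnP ex) => s /dispersedP ds smin.
have st : (s <= t)%N by apply: smin; apply/dispersedP.
exists s; last by move=> i; rewrite -(position_dispersed st).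
by split=> // r rs /dispersedP /smin; rewrite leqNgt rs.
Qed.

Lemma measurable_stops_within : measurable good.
Proof.
rewrite stops_withinE; apply: bigcupT_measurable => t.
exact: (measurable_position t (fun x => ~~ (unsettled x || far x))).
Qed.

Lemma prob_stops_within : (1 - ((3 / 4) ^+ n * 4)%:E <= P good)%E.
Proof.
have r0 : 0 < rate R n by rewrite mulr_gt0 ?exprn_gt0 ?invr_gt0.
have q0 : 0 < (3 / 4 : R) ^+ n by rewrite exprn_gt0.
(* A time so large that both error terms are at most [(3 / 4) ^+ n]; doubled by the initial energy,
   they add up to the factor 4. *)
have [t t0 tq] : exists2 t, (0 < t)%N & (t%:R * rate R n)^-1 <= (3 / 4) ^+ n.
  have a0 : 0 <= ((3 / 4) ^+ n * rate R n)^-1.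
    by rewrite invr_ge0 mulr_ge0 ?ltW.
  have := archi_boundP a0; set t := Num.Def.archi_bound _ => at_.
  have t0 : 0 < t%:R :> R by exact: le_lt_trans at_.
  exists t; first by rewrite -(ltr0n R).
  rewrite invf_ple ?posrE ?mulr_gt0// ltW//.
  by move: at_; rewrite invfM -ltr_pdivrMr// invrK.
pose bad (x : 'I_n -> int) := unsettled x || far x.
have mb : measurable [set w | bad (position (coins w) t)].
  exact: measurable_position.
apply: (@le_trans _ _ (P (~` [set w | bad (position (coins w) t)]))).
  rewrite probability_setC// leeB//.
  apply: (le_trans (prob_position_le _ _)); rewrite lee_fin.
  apply: (le_trans (mean_after_bad _ _ t0)); lra.
apply: le_measure; rewrite ?inE.
- exact: measurableC.
- exact: measurable_stops_within.
- by rewrite stops_withinE => w /= /negP bw; exists t.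
Qed.

End Law.

Theorem theorem1 (R : realType) :
  exists2 K : R, 0 < K &
    forall (d : nat -> measure_display)
           (Omega : forall n : nat, measurableType (d n))
           (P : forall n : nat, probability (Omega n) R)
           (X : forall n : nat, (nat * 'I_n)%type -> {RV (P n) >-> bool}),
      (forall n : nat, iid_fair_coins (X n)) ->
      P n [set w : Omega n |
            stops_within (K * n%:R) (fun (t : nat) (i : 'I_n) => X n (t, i) w)]
        @[n --> \oo] --> 1%E.
Proof.
exists 5 => // d Omega P X coinsX.
(* The bound holds for each [n] separately, so nothing is assumed on how the probability spaces are
   related. *)
apply: (@squeeze_cvge _ _ _ _ (fun n => 1 - ((3 / 4) ^+ n * 4)%:E)%E _
  (fun=> 1%E)).
- apply: nearW => n; apply/andP; split; first exact: prob_stops_within.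
  by apply: probability_le1; exact: measurable_stops_within.
- rewrite -[X in _ --> X]sube0; apply: cvgeB => //; first exact: cvg_cst.
  apply: cvg_EFin; first exact: nearW.
  rewrite -[X in _ --> X](mul0r 4); apply: cvgMl.
  by apply: cvg_expr; rewrite ger0_norm; lra.
- exact: cvg_cst.
Qed.
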